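(* Let $N>2$, let $x_1<x_2<\dots<x_N$, $I=[x_1,x_N]$, and suppose that a data set $\{(x_i,y_i): i=1,\dots,N\}$ is given, where $y_i\ge p_i:=p(x_i)$ for all $i=1,\dots,N$ and $p$ is a piecewise quadratic function on $I$ with knots at $x_i$; write $p_i'=p'(x_i)$. Let $d_i$ be the derivative values at the knots $x_i$, and let $f^\alpha$ be the rational cubic spline fractal interpolation function (defined in the context) with scaling factors $\alpha_i$ and positive shape parameters $r_i,t_i$, $i=1,\dots,N-1$. Then a sufficient condition for $f^\alpha$ to lie above $p$ (that is, $f^\alpha(x)\ge p(x)$ for all $x\in I$) is that the parameters satisfy the following inequalities: (i) $|\alpha_i|<a_i$ for $i=1,\dots,N-1$, and $|\alpha|_\infty\le\min\Big\{\dfrac{y_i-p_i}{y_i-p_i+M}: i=1,\dots,N\Big\}$; (ii) $r_i(2y_i-2p_i+h_id_i-h_ip_i'+2K)+t_i(y_i-p_i+K)\ge0$ for $i=1,\dots,N-1$; (iii) $r_i(y_{i+1}-p_{i+1}+K)+t_i(2y_{i+1}-2p_i-h_id_{i+1}-h_ip_i'+2K)\ge0$ for $i=1,\dots,N-1$; where $$M=|y|_\infty+\max\{|y_1|,|y_N|\}+\frac14\big(h|d|_\infty+|I|\max\{|d_1|,|d_N|\}\big),\qquad K=\frac{|\alpha|_\infty}{|\alpha|_\infty-1}M.$$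
   Context: Notation: $h_i=x_{i+1}-x_i$, $h=\max_{1\le i\le N-1}h_i$, $|I|=x_N-x_1$, $a_i=h_i/|I|$, $|y|_\infty=\max_{1\le i\le N}|y_i|$, $|d|_\infty=\max_{1\le i\le N}|d_i|$, $|\alpha|_\infty=\max_{1\le i\le N-1}|\alpha_i|$. The piecewise quadratic function $p$ is given on $[x_i,x_{i+1}]$ by $p(x)=p_i(1-\varphi)^2+(2p_i+p_i'h_i)\varphi(1-\varphi)+p_{i+1}\varphi^2$, $\varphi=\frac{x-x_i}{h_i}$; thus $p_i'$ is the derivative at $x_i$ of the quadratic piece of $p$ on $[x_i,x_{i+1}]$. Let $L_i:I\to[x_i,x_{i+1}]$ be the affine map with $L_i(x_1)=x_i$, $L_i(x_N)=x_{i+1}$. Given real $\alpha_i$ with $|\alpha_i|<a_i$ and positive shape parameters $r_i,t_i$ $(i=1,\dots,N-1)$, the rational cubic spline fractal interpolation function (FIF) $f^\alpha$ is the unique continuous function on $I$ with $$f^\alpha(L_i(x))=\alpha_if^\alpha(x)+\frac{P_i(x)}{Q_i(x)},\quad x\in I,\ i=1,\dots,N-1,$$ where, with $\theta=\frac{x-x_1}{x_N-x_1}$, $$\begin{aligned}P_i(x)=\;&(y_i-\alpha_iy_1)r_i(1-\theta)^3+(y_{i+1}-\alpha_iy_N)t_i\theta^3\\&+\big\{(2r_i+t_i)y_i+r_ih_id_i-\alpha_i[(2r_i+t_i)y_1+r_i(x_N-x_1)d_1]\big\}\theta(1-\theta)^2\\&+\big\{(r_i+2t_i)y_{i+1}-t_ih_id_{i+1}-\alpha_i[(r_i+2t_i)y_N-t_i(x_N-x_1)d_N]\big\}\theta^2(1-\theta),\\Q_i(x)=\;&(1-\theta)r_i+\theta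 t_i.\end{aligned}$$ It is $\mathcal{C}^1$ and satisfies $f^\alpha(x_i)=y_i$. *)

(* Defs.v *)
(* Sequences nat -> R are 1-based: the data use only the indices 1..N, and the *)
(* parameters attached to a subinterval only 1..N-1; other values are ignored. *)
From mathcomp Require Import all_boot all_order all_algebra.
From mathcomp Require Import all_classical all_reals all_analysis.
From mathcomp Require Import ring.
Import Order.TTheory GRing.Theory Num.Theory.
Import numFieldNormedType.Exports.

Set Implicit Arguments.
Unset Strict Implicit.
Unset Printing Implicit Defensive.

Local Open Scope ring_scope.
Local Open Scope classical_set_scope.

Definition knot_step (R : realType) (x : nat -> R) (i : nat) : R :=
  x i.+1 - x i.

Definition knot_len (R : realType) (N : nat) (x : nat -> R) : R := x N - x 1%N.

Definition step_ratio (R : realType) (N : nat) (x : nat -> R) (i : nat) : R :=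
  knot_step x i / knot_len N x.

(* max {u_i : 1 <= i <= n}, for nonnegative u and n >= 1 *)
Definition maxseq (R : realType) (n : nat) (u : nat -> R) : R :=
  \big[Num.max/0]_(1 <= i < n.+1) u i.

(* min {u_i : 1 <= i <= n}, for n >= 1 *)
Definition minseq (R : realType) (n : nat) (u : nat -> R) : R :=
  \big[Num.min/u 1%N]_(1 <= i < n.+1) u i.

Definition sup_norm (R : realType) (n : nat) (u : nat -> R) : R :=
  maxseq n (fun i => `|u i|).

(* The quadratic on [a, a + h] with end values p0 and p1 and slope dp0 at a,   *)
(* in the Bernstein basis.                                                     *)
Definition quad_piece (R : realType) (a h p0 dp0 p1 u : R) : R :=
  let phi := (u - a) / h in
  p0 * (1 - phi) ^+ 2 + (2 * p0 + dp0 * h) * phi * (1 - phi) + p1 * phi ^+ 2.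

(* dp i is the derivative at x_i of the piece on [x_i, x_{i+1}], see           *)
(* quad_piece_derive; p itself need not be differentiable at the knots.        *)
Definition piecewise_quadratic (R : realType) (N : nat) (x : nat -> R)
    (p : R -> R) (dp : nat -> R) : Prop :=
  forall i, (1 <= i < N)%N -> forall u, x i <= u <= x i.+1 ->
    p u = quad_piece (x i) (knot_step x i) (p (x i)) (dp i) (p (x i.+1)) u.

Lemma quad_piece_derive (R : realType) (a h p0 dp0 p1 : R) (h_neq0 : h != 0) :
  is_derive a 1 (quad_piece a h p0 dp0 p1) dp0.
Proof.
rewrite /quad_piece; apply: is_derive_eq.
rewrite /GRing.scale /= subrr.
by field.
Qed.

(* Every polynomial of degree at most 2 has this form.                         *)
Lemma quad_pieceE (R : realType) (a h c0 c1 c2 u : R) (h_neq0 : h != 0) :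
  c0 + c1 * (u - a) + c2 * (u - a) ^+ 2 =
  quad_piece a h c0 c1 (c0 + c1 * h + c2 * h ^+ 2) u.
Proof. by rewrite /quad_piece; field. Qed.

Definition affL (R : realType) (N : nat) (x : nat -> R) (i : nat) (u : R) : R :=
  x i + step_ratio N x i * (u - x 1%N).

Lemma affL_left (R : realType) (N : nat) (x : nat -> R) (i : nat) :
  affL N x i (x 1%N) = x i.
Proof. by rewrite /affL subrr mulr0 addr0. Qed.

Lemma affL_right (R : realType) (N : nat) (x : nat -> R) (i : nat) :
  x 1%N != x N -> affL N x i (x N) = x i.+1.
Proof.
move=> x1N; rewrite /affL /step_ratio /knot_step /knot_len.
rewrite divfK ?subr_eq0 1?eq_sym //.
by rewrite addrC subrK.
Qed.

Definition knot_theta (R : realType) (N : nat) (x : nat -> R) (u : R) : R :=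
  (u - x 1%N) / (x N - x 1%N).

Definition fifP (R : realType) (N : nat) (x y d alpha r t : nat -> R)
    (i : nat) (u : R) : R :=
  let th := knot_theta N x u in
  (y i - alpha i * y 1%N) * r i * (1 - th) ^+ 3
  + (y i.+1 - alpha i * y N) * t i * th ^+ 3
  + ((2 * r i + t i) * y i + r i * knot_step x i * d i
     - alpha i * ((2 * r i + t i) * y 1%N + r i * (x N - x 1%N) * d 1%N))
    * th * (1 - th) ^+ 2
  + ((r i + 2 * t i) * y i.+1 - t i * knot_step x i * d i.+1
     - alpha i * ((r i + 2 * t i) * y N - t i * (x N - x 1%N) * d N))
    * th ^+ 2 * (1 - th).

Definition fifQ (R : realType) (N : nat) (x r t : nat -> R) (i : nat) (u : R)
    : R :=
  let th := knot_theta N x u in (1 - th) * r i + th * t i.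

(* f is the rational cubic spline FIF; its values outside [x_1, x_N] are       *)
(* irrelevant.                                                                 *)
Definition rational_cubic_fif (R : realType) (N : nat)
    (x y d alpha r t : nat -> R) (f : R -> R) : Prop :=
  {within `[x 1%N, x N], continuous f} /\
  forall i, (1 <= i < N)%N -> forall u, x 1%N <= u <= x N ->
    f (affL N x i u) =
      alpha i * f u + fifP N x y d alpha r t i u / fifQ N x r t i u.

(* In minseq N (fun i => (y i - p (x i)) / (y i - p (x i) + M)) a denominator  *)
(* vanishes only if M = 0 and y i = p (x i); the quotient is then 0.           *)
Definition constM (R : realType) (N : nat) (x y d : nat -> R) : R :=
  sup_norm N y + Num.max `|y 1%N| `|y N|
  + 4^-1 * (maxseq N.-1 (knot_step x) * sup_norm N d
            + knot_len N x * Num.max `|d 1%N| `|d N|).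

Definition constK (R : realType) (N : nat) (x y d alpha : nat -> R) : R :=
  sup_norm N.-1 alpha / (sup_norm N.-1 alpha - 1) * constM N x y d.

(* Main.v *)
(** Let S be the classical rational cubic interpolant, obtained for zero scaling
    factors, and B_i the analogous function on the whole of I built from the end
    data only, with the shape parameters r_i, t_i.  The functional equation reads
    (f - S) o L_i = alpha_i (f - B_i), and |S| + |B_i| <= M, so e := sup |f - S|
    satisfies e <= |alpha| (e + M), whence f >= S + K.  Finally (S + K - p) Q_i is
    a cubic on each subinterval, whose Bernstein-type coefficients are nonnegative:
    the inner ones are (ii) and (iii), the outer ones follow from (i). *)
Require Import Defs.
From mathcomp Require Import all_boot all_order all_algebra.
From mathcomp Require Import all_classical all_reals all_analysis.
From mathcomp Require Import ring lra.
Import Order.TTheory GRing.Theory Num.Theory.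
Import numFieldNormedType.Exports.

Set Implicit Arguments.
Unset Strict Implicit.
Unset Printing Implicit Defensive.

Local Open Scope ring_scope.
Local Open Scope classical_set_scope.

(** * Finite maxima and minima *)

Lemma maxseq_ge (R : realType) (n : nat) (u : nat -> R) (i : nat) :
  (1 <= i <= n)%N -> u i <= maxseq n u.
Proof. by move=> ?; apply: le_bigmax_seq; rewrite // mem_index_iota ltnS. Qed.

Lemma maxseq_ge0 (R : realType) (n : nat) (u : nat -> R) : 0 <= maxseq n u.
Proof. exact: bigmax_ge_id. Qed.

Lemma maxseq_lt (R : realType) (n : nat) (u : nat -> R) (c : R) :
  0 < c -> (forall i, (1 <= i <= n)%N -> u i < c) -> maxseq n u < c.
Proof.
move=> c0 uc; rewrite /maxseq big_nat; apply: bigmax_lt => // i; exact: uc.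
Qed.

Lemma minseq_le (R : realType) (n : nat) (u : nat -> R) (i : nat) :
  (1 <= i <= n)%N -> minseq n u <= u i.
Proof. by move=> ?; apply: ge_bigmin_seq; rewrite // mem_index_iota ltnS. Qed.

(** * Knots and the affine maps of the iterated function system *)

Lemma knots_le (R : realType) (N : nat) (x : nat -> R) :
  (forall i, (1 <= i < N)%N -> x i < x i.+1) ->
  forall i j, (1 <= i <= j)%N -> (j <= N)%N -> x i <= x j.
Proof.
move=> xS i; elim=> [|j IH] /andP[i1]; first by move: i1; case: i.
rewrite leq_eqVlt ltnS => /predU1P[->//|ij] jN.
apply: le_trans (IH _ (ltnW jN)) (ltW (xS _ _)); first by rewrite i1.
by rewrite jN (leq_trans i1).
Qed.

Lemma knots_cover (R : realType) (N : nat) (x : nat -> R) (u : R) :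
  (1 < N)%N -> x 1%N <= u <= x N ->
  exists2 i, (1 <= i < N)%N & x i <= u <= x i.+1.
Proof.
move=> + /andP[x1u]; elim: N => // -[//|N] IH _ uN.
have [uN'|/ltW N'u] := leP u (x N.+1); last first.
  by exists N.+1; rewrite ?ltnSn // N'u.
case: N => [|N] in IH uN uN' *; first by exists 1%N; rewrite // x1u.
have [//|i /andP[i1 iN] iu] := IH _ uN'.
by exists i; rewrite // i1 ltnW.
Qed.

(** This makes the functional equation, which speaks only of values at [affL N x i u], available at
    every point of the interval. *)
Lemma affL_cover (R : realType) (N : nat) (x : nat -> R) (v : R) :
  (1 < N)%N -> (forall i, (1 <= i < N)%N -> x i < x i.+1) ->
  x 1%N <= v <= x N ->
  exists i u, [/\ (1 <= i < N)%N, x 1%N <= u <= x N & v = affL N x i u].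
Proof.
move=> N1 xS /(knots_cover N1)[i iN /andP[xiv vxi]].
have h0 : 0 < x i.+1 - x i by rewrite subr_gt0 xS.
have I0 : 0 < x N - x 1%N.
  by rewrite subr_gt0 (lt_le_trans (xS 1%N _)) // (knots_le xS).
(* The preimage of [v] under the affine map, found by solving [v = affL N x i u] for [u]. *)
exists i, (x 1%N + (v - x i) / (x i.+1 - x i) * (x N - x 1%N)); split=> //.
  have phi0 : 0 <= (v - x i) / (x i.+1 - x i).
    by rewrite divr_ge0 ?(ltW h0) ?subr_ge0.
  have phi1 : (v - x i) / (x i.+1 - x i) <= 1.
    by rewrite ler_pdivrMr // mul1r lerD2r.
  rewrite lerDl mulr_ge0 ?(ltW I0) //= -lerBrDl.
  by rewrite ler_piMl // ltW.
rewrite /affL /step_ratio /knot_step /knot_len; field.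
by rewrite !gt_eqF.
Qed.

Lemma knot_theta_itv (R : realType) (N : nat) (x : nat -> R) (u : R) :
  x 1%N < x N -> x 1%N <= u <= x N -> 0 <= knot_theta N x u <= 1.
Proof.
move=> x1N /andP[x1u uN]; rewrite /knot_theta.
by rewrite divr_ge0 ?ler_pdivrMr ?subr_gt0 ?subr_ge0 ?mul1r ?lerD2r // ltW.
Qed.

Lemma affL_itv (R : realType) (N : nat) (x : nat -> R) (i : nat) (u : R) :
  x 1%N < x N -> x i <= x i.+1 -> x 1%N <= u <= x N ->
  x i <= affL N x i u <= x i.+1.
Proof.
move=> x1N xS /(knot_theta_itv x1N)/andP[th0 th1].
have -> : affL N x i u = x i + (x i.+1 - x i) * knot_theta N x u.
  rewrite /affL /step_ratio /knot_step /knot_len /knot_theta; field.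
  by rewrite subr_eq0 gt_eqF.
by rewrite lerDl mulr_ge0 ?subr_ge0 //= -lerBrDl ler_piMr // subr_ge0.
Qed.

(** * Bounds for a single rational cubic piece *)

(* The rational cubic with end values [y0], [y1] and slopes [e0], [e1] in the
   parameter [th]; shared by the pieces of S and by the B_i. *)
Definition rational_cubic (R : realType) (r t y0 y1 e0 e1 th : R) : R :=
  (y0 * r * (1 - th) ^+ 3 + y1 * t * th ^+ 3
   + ((2 * r + t) * y0 + r * e0) * th * (1 - th) ^+ 2
   + ((r + 2 * t) * y1 - t * e1) * th ^+ 2 * (1 - th))
  / ((1 - th) * r + th * t).

Lemma convex_gt0 (R : realType) (r t th : R) :
  0 < r -> 0 < t -> 0 <= th <= 1 -> 0 < (1 - th) * r + th * t.
Proof.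
move=> r0 t0 /andP[th0 th1]; have [->|th_neq1] := eqVneq th 1.
  by rewrite subrr mul0r add0r mul1r.
rewrite ltr_pwDl ?mulr_ge0 ?(ltW t0) // mulr_gt0 //.
by rewrite subr_gt0 lt_neqAle th_neq1.
Qed.

(** The numerator is [y0 * A + y1 * B + e0 * C - e1 * D] with nonnegative weights. With Q the
    denominator, A + B = Q and C + D = th (1 - th) Q, where th (1 - th) is at most 1/4; this is the
    origin of the factor 1/4 in [constM]. *)
Lemma rational_cubic_norm_le (R : realType) (r t y0 y1 e0 e1 th Y E : R) :
  0 < r -> 0 < t -> 0 <= th <= 1 ->
  `|y0| <= Y -> `|y1| <= Y -> `|e0| <= E -> `|e1| <= E ->
  `|rational_cubic r t y0 y1 e0 e1 th| <= Y + 4^-1 * E.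
Proof.
move=> r0 t0 th01 y0Y y1Y e0E e1E.
have Q0 := convex_gt0 r0 t0 th01; case/andP: th01 => th0 th1.
rewrite /rational_cubic normrM normfV (gtr0_norm Q0) ler_pdivrMr //.
have s0 : 0 <= 1 - th by rewrite subr_ge0.
have [r0' t0'] := (ltW r0, ltW t0).
set A := r * (1 - th) ^+ 3 + (2 * r + t) * th * (1 - th) ^+ 2.
set B := t * th ^+ 3 + (r + 2 * t) * th ^+ 2 * (1 - th).
set C := r * th * (1 - th) ^+ 2.
set D := t * th ^+ 2 * (1 - th).
have A0 : 0 <= A by rewrite /A !(s0, addr_ge0, mulr_ge0, exprn_ge0).
have B0 : 0 <= B by rewrite /B !(s0, addr_ge0, mulr_ge0, exprn_ge0).
have C0 : 0 <= C by rewrite /C !(mulr_ge0, exprn_ge0).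
have D0 : 0 <= D by rewrite /D !(mulr_ge0, exprn_ge0).
have -> : y0 * r * (1 - th) ^+ 3 + y1 * t * th ^+ 3
   + ((2 * r + t) * y0 + r * e0) * th * (1 - th) ^+ 2
   + ((r + 2 * t) * y1 - t * e1) * th ^+ 2 * (1 - th)
   = y0 * A + y1 * B + e0 * C - e1 * D by rewrite /A /B /C /D; ring.
have QE : (1 - th) * r + th * t = A + B by rewrite /A /B; ring.
have CD : C + D = th * (1 - th) * ((1 - th) * r + th * t).
  by rewrite /C /D; ring.
have th4 : th * (1 - th) <= 4^-1.
  have := sqr_ge0 (th - 2^-1); rewrite expr2; lra.
have E0 : 0 <= E by apply: le_trans e0E.
apply: (@le_trans _ _ (Y * (A + B) + E * (C + D))).
  apply: (@le_trans _ _ (`|y0| * A + `|y1| * B + `|e0| * C + `|e1| * D)).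
    rewrite -[X in `|y0| * X](ger0_norm A0) -[X in `|y1| * X](ger0_norm B0).
    rewrite -[X in `|e0| * X](ger0_norm C0) -[X in `|e1| * X](ger0_norm D0).
    rewrite -!normrM (le_trans (ler_normB _ _)) // lerD2r.
    by rewrite (le_trans (ler_normD _ _)) // lerD2r ler_normD.
  by rewrite (mulrDr Y) (mulrDr E) addrA !lerD ?ler_wpM2r.
rewrite mulrDl -QE lerD2l CD mulrA ler_wpM2r ?(ltW Q0) //.
by rewrite mulrC ler_wpM2r.
Qed.

(** The numerator is linear in the end values and slopes, and both rational cubics share the
    denominator [fifQ]. *)
Lemma fif_pieceE (R : realType) (N : nat) (x y d alpha r t : nat -> R)
    (i : nat) (u : R) :
  fifP N x y d alpha r t i u / fifQ N x r t i u =
  rational_cubic (r i) (t i) (y i) (y i.+1)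
    (knot_step x i * d i) (knot_step x i * d i.+1) (knot_theta N x u)
  - alpha i * rational_cubic (r i) (t i) (y 1%N) (y N)
      (knot_len N x * d 1%N) (knot_len N x * d N) (knot_theta N x u).
Proof.
rewrite /fifP /fifQ /rational_cubic /knot_len [alpha i * (_ / _)]mulrA -mulrBl.
congr (_ / _).
by ring.
Qed.

Lemma quad_piece_le_rational_cubic
    (R : realType) (r t y0 y1 e0 e1 p0 p1 a h dp0 K u : R) :
  0 < r -> 0 < t -> 0 <= (u - a) / h <= 1 ->
  0 <= y0 - p0 + K -> 0 <= y1 - p1 + K ->
  0 <= r * (2 * y0 - 2 * p0 + e0 - h * dp0 + 2 * K) + t * (y0 - p0 + K) ->
  0 <= r * (y1 - p1 + K) + t * (2 * y1 - 2 * p0 - e1 - h * dp0 + 2 * K) ->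
  quad_piece a h p0 dp0 p1 u <=
    rational_cubic r t y0 y1 e0 e1 ((u - a) / h) + K.
Proof.
rewrite /quad_piece; set th := (u - a) / h => r0 t0 th01 c0 c3 c1 c2.
have Q0 := convex_gt0 r0 t0 th01; case/andP: th01 => th0 th1.
have s0 : 0 <= 1 - th by rewrite subr_ge0.
rewrite /rational_cubic -lerBlDr ler_pdivlMr // -subr_ge0.
set c := (X in 0 <= X).
(* Everything is made homogeneous of degree 3 in [1 - th] and [th]: the quadratic is multiplied by
   the linear denominator Q, and K Q by the square of (1 - th) + th. Binomial factors are absorbed
   in the coefficients, which are then the four hypotheses, the outer two up to a factor [r] or
   [t]. *)
have -> : c = r * (y0 - p0 + K) * (1 - th) ^+ 3
  + (r * (2 * y0 - 2 * p0 + e0 - h * dp0 + 2 * K) + t * (y0 - p0 + K))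
    * th * (1 - th) ^+ 2
  + (r * (y1 - p1 + K) + t * (2 * y1 - 2 * p0 - e1 - h * dp0 + 2 * K))
    * th ^+ 2 * (1 - th)
  + t * (y1 - p1 + K) * th ^+ 3 by rewrite /c; ring.
have [r0' t0'] := (ltW r0, ltW t0).
by rewrite !(th0, s0, c0, c1, c2, c3, addr_ge0, mulr_ge0, exprn_ge0).
Qed.

(** * Distance from the fractal function to the classical interpolant *)

Lemma segment_continuous_bounded (R : realType) (a b : R) (f : R -> R) :
  a <= b -> {within `[a, b], continuous f} ->
  exists F, forall u, a <= u <= b -> `|f u| <= F.
Proof.
move=> ab fc.
have [c _ fle] := EVT_max ab fc; have [c' _ fge] := EVT_min ab fc.
exists (Num.max `|f c| `|f c'|) => u uab.
have {}fle := fle u uab; have {}fge := fge u uab.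
rewrite le_max; have [u0|/ltW u0] := leP 0 (f u).
  by rewrite (ger0_norm u0) (le_trans fle) // ler_norm.
by rewrite orbC (ler0_norm u0) (ler0_norm (le_trans fge u0)) lerN2 fge.
Qed.

(** No subinterval is longer than the whole interval, so each [step_ratio] is at most 1; strictness
    survives a maximum over finitely many indices. *)
Lemma sup_norm_scaling_lt1 (R : realType) (N : nat) (x alpha : nat -> R) :
  (1 < N)%N -> (forall i, (1 <= i < N)%N -> x i < x i.+1) ->
  (forall i, (1 <= i < N)%N -> `|alpha i| < step_ratio N x i) ->
  sup_norm N.-1 alpha < 1.
Proof.
move=> N1 xS alpha_lt; apply: maxseq_lt => // i iN.
have {}iN : (1 <= i < N)%N by case: (N) N1 iN.
have I0 : 0 < knot_len N x.
  by rewrite subr_gt0 (lt_le_trans (xS 1%N _)) // (knots_le xS).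
rewrite (lt_le_trans (alpha_lt i iN)) // ler_pdivrMr // mul1r.
by case/andP: iN => i1 iN; rewrite lerB // (knots_le xS) ?i1 ?(ltnW iN).
Qed.

Lemma constM_ge0 (R : realType) (N : nat) (x y d : nat -> R) :
  x 1%N <= x N -> 0 <= constM N x y d.
Proof.
move=> x1N; rewrite /constM /sup_norm.
have l0 : 0 <= knot_len N x by rewrite subr_ge0.
have m0 u v : 0 <= Num.max `|u : R| `|v| by rewrite le_max normr_ge0.
by rewrite !(l0, m0, maxseq_ge0, addr_ge0, mulr_ge0) ?invr_ge0.
Qed.

Lemma fif_perturbation (R : realType) (N : nat) (x y d alpha r t : nat -> R)
    (f : R -> R) :
  (1 < N)%N ->
  (forall i, (1 <= i < N)%N -> x i < x i.+1) ->
  (forall i, (1 <= i < N)%N -> 0 < r i) ->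
  (forall i, (1 <= i < N)%N -> 0 < t i) ->
  rational_cubic_fif N x y d alpha r t f ->
  sup_norm N.-1 alpha < 1 ->
  forall i u, (1 <= i < N)%N -> x 1%N <= u <= x N ->
  `|f (affL N x i u) - rational_cubic (r i) (t i) (y i) (y i.+1)
      (knot_step x i * d i) (knot_step x i * d i.+1) (knot_theta N x u)|
  <= - constK N x y d alpha.
Proof.
move=> N1 xS r0 t0 [f_cont f_eq] a1.
have x1N : x 1%N < x N.
  by rewrite (lt_le_trans (xS 1%N _)) // (knots_le xS).
pose S i u := rational_cubic (r i) (t i) (y i) (y i.+1)
  (knot_step x i * d i) (knot_step x i * d i.+1) (knot_theta N x u).
pose B i u := rational_cubic (r i) (t i) (y 1%N) (y N)
  (knot_len N x * d 1%N) (knot_len N x * d N) (knot_theta N x u).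
(* [constM] splits into a bound [MS] for the pieces of S and a bound [MB] for the B_i. *)
pose MS := sup_norm N y + 4^-1 * (maxseq N.-1 (knot_step x) * sup_norm N d).
pose MB := Num.max `|y 1%N| `|y N|
  + 4^-1 * (knot_len N x * Num.max `|d 1%N| `|d N|).
have ME : constM N x y d = MS + MB by rewrite /constM /MS /MB; ring.
have S_le i u : (1 <= i < N)%N -> x 1%N <= u <= x N -> `|S i u| <= MS.
  move=> iN uI; have h0 : 0 <= knot_step x i by rewrite subr_ge0 ltW ?xS.
  have /andP[i1 ltiN] := iN.
  have hle : knot_step x i <= maxseq N.-1 (knot_step x).
    by apply: maxseq_ge; case: (N) N1 iN.
  have seq_le v j : (1 <= j <= N)%N -> `|v j : R| <= sup_norm N v.
    by move=> jN; apply: (@maxseq_ge _ _ (fun k => `|v k|)).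
  apply: rational_cubic_norm_le;
    rewrite ?r0 ?t0 ?knot_theta_itv ?seq_le ?i1 ?(ltnW ltiN) //.
  - by rewrite normrM (ger0_norm h0) ler_pM // seq_le // i1 ltnW.
  - by rewrite normrM (ger0_norm h0) ler_pM // seq_le.
have B_le i u : (1 <= i < N)%N -> x 1%N <= u <= x N -> `|B i u| <= MB.
  move=> iN uI; have l0 : 0 <= knot_len N x by rewrite subr_ge0 ltW.
  apply: rational_cubic_norm_le; rewrite ?r0 ?t0 ?knot_theta_itv ?le_max ?lexx
    ?orbT // normrM (ger0_norm l0) ler_wpM2l // le_max lexx ?orbT //.
have [F fF] := segment_continuous_bounded (ltW x1N) f_cont.
(* The supremum runs over pairs [(i, u)], so the pieces of S need not be glued into one function on
   the interval. Continuity of [f] enters only to make it finite. *)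
pose E := [set e | exists i u,
  [/\ (1 <= i < N)%N, x 1%N <= u <= x N & e = `|f (affL N x i u) - S i u|]].
set a := sup_norm N.-1 alpha in a1 *.
have a0 : 0 <= a by apply: maxseq_ge0.
have E0 : E !=set0.
  by exists `|f (affL N x 1 (x 1%N)) - S 1%N (x 1%N)|, 1%N, (x 1%N);
    rewrite lexx (ltW x1N).
have affL_I i u : (1 <= i < N)%N -> x 1%N <= u <= x N ->
    x 1%N <= affL N x i u <= x N.
  move=> iN uI; have /andP[i1 ltiN] := iN.
  have /andP[l1 l2] := affL_itv x1N (ltW (xS i iN)) uI.
  by rewrite (le_trans _ l1) ?(le_trans l2) ?(knots_le xS) ?i1 ?(ltnW ltiN).
have E_sup : has_sup E.
  split=> //; exists (F + MS) => _ [i [u [iN uI ->]]].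
  by rewrite (le_trans (ler_normB _ _)) // lerD ?S_le // fF // affL_I.
have E_ub : ubound E (sup E) by apply: sup_upper_bound.
have sup_le : sup E <= a * (sup E + constM N x y d).
  apply: ge_sup => // _ [i [u [iN uI ->]]].
  have -> : f (affL N x i u) - S i u = alpha i * (f u - B i u).
    by rewrite f_eq // fif_pieceE -/(S i u) -/(B i u); ring.
  have alpha_le : `|alpha i| <= a.
    by apply: (@maxseq_ge _ _ (fun k => `|alpha k|)); case: (N) N1 iN.
  rewrite normrM ler_pM // (le_trans (ler_normB _ _)) //.
  rewrite ME addrA lerD ?B_le //.
  (* To compare [f u] with S, the point [u] is itself written as an image under some [affL N x j];
     the difference there is again an element of [E]. *)
  have [j [w [jN wI ->]]] := affL_cover N1 xS uI.
  rewrite -[f _](subrK (S j w)) (le_trans (ler_normD _ _)) // lerD ?S_le //.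
  by apply: E_ub; exists j, w.
move=> i u iN uI; apply: (@le_trans _ _ (sup E)).
  by apply: E_ub; exists i, u.
(* Solving e <= a (e + M) for e gives a M / (1 - a), which is -K; in particular K is nonpositive. *)
have -> : - constK N x y d alpha = a * constM N x y d / (1 - a).
  by rewrite /constK -/a; field; rewrite !subr_eq0 gt_eqF // lt_eqF.
rewrite ler_pdivlMr ?subr_gt0 //; lra.
Qed.

(** Clearing denominators, both the bound on [a] and the conclusion read a M <= g (1 - a). *)
Lemma gap_constK_ge0 (R : realType) (a g M : R) :
  0 <= g -> 0 <= M -> a < 1 -> a <= g / (g + M) -> 0 <= g + a / (a - 1) * M.
Proof.
move=> g0 M0 a1 age.
have -> : a / (a - 1) * M = - (a * M / (1 - a)).
  by field; rewrite !subr_eq0 gt_eqF // lt_eqF.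
rewrite subr_ge0 ler_pdivrMr ?subr_gt0 //.
(* Here the quotient has the default value 0 and its denominator cannot be cleared, but [g] and [M]
   both vanish. *)
have [gM0|gM0] := eqVneq (g + M) 0.
  have g_eq0 : g = 0 by lra.
  have M_eq0 : M = 0 by lra.
  by rewrite g_eq0 M_eq0 mulr0 mul0r.
move: age; rewrite ler_pdivlMr; first by lra.
by rewrite lt_neqAle eq_sym gM0 addr_ge0.
Qed.

Theorem theorem5p2 (R : realType) (N : nat) (x y d dp alpha r t : nat -> R)
    (p f : R -> R)
    (N_gt2 : (2 < N)%N)
    (x_incr : forall i : nat, (1 <= i < N)%N -> x i < x i.+1)
    (p_quad : piecewise_quadratic N x p dp)
    (y_ge_p : forall i : nat, (1 <= i <= N)%N -> y i >= p (x i))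
    (r_gt0 : forall i : nat, (1 <= i < N)%N -> 0 < r i)
    (t_gt0 : forall i : nat, (1 <= i < N)%N -> 0 < t i)
    (f_fif : rational_cubic_fif N x y d alpha r t f)
    (cond_i_ratio : forall i : nat, (1 <= i < N)%N ->
       `|alpha i| < step_ratio N x i)
    (cond_i_min : sup_norm N.-1 alpha <=
       minseq N (fun i => (y i - p (x i)) / (y i - p (x i) + constM N x y d)))
    (cond_ii : forall i : nat, (1 <= i < N)%N ->
       r i * (2 * y i - 2 * p (x i) + knot_step x i * d i - knot_step x i * dp i
              + 2 * constK N x y d alpha)
       + t i * (y i - p (x i) + constK N x y d alpha) >= 0)
    (cond_iii : forall i : nat, (1 <= i < N)%N ->
       r i * (y i.+1 - p (x i.+1) + constK N x y d alpha)
       + t i * (2 * y i.+1 - 2 * p (x i) - knot_step x i * d i.+1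
                - knot_step x i * dp i + 2 * constK N x y d alpha) >= 0) :
  forall u : R, x 1%N <= u <= x N -> f u >= p u.
Proof.
have N1 : (1 < N)%N by exact: ltnW.
have x1N : x 1%N < x N.
  by rewrite (lt_le_trans (x_incr 1%N _)) // (knots_le x_incr) // N1.
have a1 := sup_norm_scaling_lt1 N1 x_incr cond_i_ratio.
(* These are the outer coefficients of the cubic, at both ends of each subinterval. *)
have gap i : (1 <= i <= N)%N -> 0 <= y i - p (x i) + constK N x y d alpha.
  move=> iN; apply: gap_constK_ge0 => //.
  - by rewrite subr_ge0 y_ge_p.
  - by apply: constM_ge0; exact: ltW.
  - exact: le_trans cond_i_min (minseq_le _ iN).
move=> v /(affL_cover N1 x_incr)[i [u [iN uI ->]]].
have /andP[i1 ltiN] := iN.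
have := fif_perturbation N1 x_incr r_gt0 t_gt0 f_fif a1 iN uI.
(* Only the lower half of the two-sided estimate is kept: f >= S + K. *)
rewrite ler_norml opprK => /andP[+ _]; rewrite lerBrDl; apply: le_trans.
have h0 : x i.+1 - x i != 0 by rewrite subr_eq0 gt_eqF // x_incr.
have I0 : x N - x 1%N != 0 by rewrite subr_eq0 gt_eqF.
(* The local variable of the quadratic at the image point equals the global variable of the rational
   cubic at [u], so both are compared at one parameter. *)
have phiE : (affL N x i u - x i) / knot_step x i = knot_theta N x u.
  rewrite /affL /step_ratio /knot_step /knot_len /knot_theta; field.
  by rewrite h0 I0.
rewrite (p_quad i iN) ?affL_itv ?(ltW (x_incr i iN)) // -phiE.
apply: quad_piece_le_rational_cubic; rewrite ?phiE ?r_gt0 ?t_gt0 ?gap ?i1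
  ?(ltnW ltiN) ?knot_theta_itv ?cond_ii ?cond_iii //.
Qed.
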